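(* Let $n>0$ be an integer, $\varepsilon$ an ordinal and $A$ an abelian group. There exists an $A$-valued family of height $\varepsilon$ which is $n$-coherent$^{\mathrm I}$ but not $n$-trivial$^{\mathrm I}$ if and only if there exists an $A$-valued family of height $\varepsilon$ which is $n$-coherent$^{\mathrm{II}}$ but not $n$-trivial$^{\mathrm{II}}$.
   Context: $=^*$ means equality except at finitely many points; equations between functions with different domains are evaluated on the intersection of their domains. $[\varepsilon]^n$ is the set of increasing $n$-tuples from $\varepsilon$, and $\vec\alpha^i$ is $\vec\alpha$ with its $i$-th coordinate removed. Notion I. A family $\{\varphi_\gamma:\gamma\to A\mid\gamma<\varepsilon\}$ is 1-coherent$^{\mathrm I}$ if $\varphi_\gamma|_\beta-\varphi_\beta=^*0$ for all $\beta<\gamma<\varepsilon$, and 1-trivial$^{\mathrm I}$ if there is $\varphi:\varepsilon\to A$ with $\varphi|_\beta-\varphi_\beta=^*0$ for all $\beta<\varepsilon$. For $n>1$, a family $\Phi_n=\{\varphi_{\vec\beta}:\beta_0\to A\mid\vec\beta\in[\varepsilon]^n\}$ is $n$-coherent$^{\mathrm I}$ if $\sum_{i=0}^n(-1)^i\varphi_{\vec\alpha^i}=^*0$ for all $\vec\alpha\in[\varepsilon]^{n+1}$, and $n$-trivial$^{\mathrm I}$ if there is $\{\psi_{\vec\alpha}:\alpha_0\to A\mid\vec\alpha\in[\varepsilon]^{n-1}\}$ with $\sum_{i=0}^{n-1}(-1)^i\psi_{\vec\alpha^i}=^*\varphi_{\vec\alpha}$ for all $\vec\alpha\in[\varepsilon]^n$.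 Notion II. A function is 0-trivial if its support is finite. For $k\ge1$, a family $\{s_\gamma:[\gamma]^k\to A\mid\gamma<\varepsilon\}$ is $k$-coherent$^{\mathrm{II}}$ if $s_\delta|_{[\gamma]^k}-s_\gamma$ is $(k-1)$-trivial for all $\gamma\le\delta<\varepsilon$, and $k$-trivial$^{\mathrm{II}}$ if there is $t:[\varepsilon]^k\to A$ with $t|_{[\gamma]^k}-s_\gamma$ $(k-1)$-trivial for all $\gamma<\varepsilon$. Here a function $v:[\gamma]^k\to A$ is called $(k-1)$-trivial if: for $k=1$, it has finite support; for $k\ge2$, the family $\{v_\eta:[\eta]^{k-1}\to A\mid\eta<\gamma\}$, $v_\eta(\vec\xi)=v(\vec\xi,\eta)$, is $(k-1)$-trivial$^{\mathrm{II}}$ (of height $\gamma$). *)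

(* Defs.v *)
From mathcomp Require Import all_boot all_order all_algebra.
From mathcomp Require Import boolp classical_sets cardinality.
From mathcomp Require Export wochoice.

Set Implicit Arguments.
Unset Strict Implicit.
Unset Printing Implicit Defensive.
Import Order.TTheory GRing.Theory.

Local Open Scope classical_set_scope.
Local Open Scope ring_scope.

(* An ordinal e is given by a well-ordered type E: the elements of E are the
   ordinals below e, and such an ordinal g, as a set, is [below g].
   A function whose domain is an ordinal g <= e, or a set [g]^k of increasing
   k-tuples, is given by an arbitrary total extension to E, or to k.-tuple E.
   The definitions below only evaluate such functions inside their domain, so
   the choice of the extension is irrelevant. *)

Section Families.
Context {d : Order.disp_t} {E : orderType d} {A : zmodType}.

Definition below (g : E) : set E := [set x | (x < g)%O].

Definition increasing (n : nat) (a : n.-tuple E) : bool := sorted <%O a.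

Definition omit (n : nat) (i : 'I_n.+1) (a : n.+1.-tuple E) : n.-tuple E :=
  [tuple tnth a (lift i j) | j < n].

Definition eqfin (D : set E) (f g : E -> A) : Prop :=
  finite_set [set x | D x /\ f x <> g x].

Definition altsum (n : nat) (phi : n.-tuple E -> E -> A) (a : n.+1.-tuple E)
    (x : E) : A :=
  \sum_(i < n.+1) phi (omit i a) x *~ (-1) ^+ i.

(* The functions in [altsum phi a] have domain a_1 (for i = 0) or a_0, so their
   common domain is the first coordinate a_0 of a. *)
Definition coherentI (n : nat) (phi : n.-tuple E -> E -> A) : Prop :=
  forall a : n.+1.-tuple E, increasing a ->
    eqfin (below (thead a)) (altsum phi a) (fun=> 0).

(* The value at n = 0, where the notion is undefined, is a dummy; likewise in
   [fun_trivial]. *)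
Definition trivialI (n : nat) : (n.-tuple E -> E -> A) -> Prop :=
  match n return (n.-tuple E -> E -> A) -> Prop with
  | 0 => fun=> False
  | 1 => fun phi =>
      exists f : E -> A, forall b : E,
        eqfin (below b) (fun x => f x - phi [tuple b] x) (fun=> 0)
  | m.+1 => fun phi =>
      exists psi : m.-tuple E -> E -> A,
        forall a : m.+1.-tuple E, increasing a ->
          eqfin (below (thead a)) (altsum psi a) (phi a)
  end.

(* The quantification in the definition of k-triviality of a family of height D
   (an initial segment of E), relative to a notion P of (k-1)-triviality for
   functions on [g]^k; the recursion is tied in [fun_trivial]. *)
Definition trivial_with (k : nat) (P : set E -> (k.-tuple E -> A) -> Prop)
    (D : set E) (s : E -> k.-tuple E -> A) : Prop :=
  exists t : k.-tuple E -> A,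
    forall g : E, D g -> P (below g) (fun xi => t xi - s g xi).

(* [fun_trivial k D v]: the function v : [D]^k -> A is (k-1)-trivial. *)
Fixpoint fun_trivial (k : nat) : set E -> (k.-tuple E -> A) -> Prop :=
  match k return set E -> (k.-tuple E -> A) -> Prop with
  | 0 => fun _ _ => False
  | m.+1 =>
      match m return (set E -> (m.-tuple E -> A) -> Prop) ->
                     set E -> (m.+1.-tuple E -> A) -> Prop with
      | 0 => fun _ D v => finite_set [set x | D x /\ v [tuple x] <> 0]
      | l.+1 => fun P D v =>
          trivial_with P D (fun eta xi => v [tuple of rcons xi eta])
      end (@fun_trivial m)
  end.

Definition trivialII (k : nat) (D : set E) (s : E -> k.-tuple E -> A) : Prop :=
  trivial_with (@fun_trivial k) D s.

Definition coherentII (k : nat) (D : set E) (s : E -> k.-tuple E -> A) : Prop :=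
  forall g e : E, D g -> D e -> (g <= e)%O ->
    fun_trivial (below g) (fun xi => s e xi - s g xi).

End Families.

(* Main.v *)
Require Import Defs.
From mathcomp Require Import all_boot all_order all_algebra.
From mathcomp Require Import boolp classical_sets functions cardinality.
From mathcomp Require Import wochoice.

(* For a system of quotients M / T x of an abelian group M by subgroups T x
   (x in E, shrinking as x grows), call cohomology in degree m the m-cocycles
   b |-> phi_b in M / T b_0, b increasing of length m, modulo coboundaries.
   Notion I is degree n for M = A^E and T x = finite support below x; notion II
   is degree 1 for the systems of (n-1)-trivial functions. The latter are
   obtained by iterating (M, T) |-> (M^E, T'), where T' x v means that some t in
   M agrees with v y modulo T y for all y < x, so it suffices that this
   operation lowers the degree by one (dimension shifting).
   If E has a maximum, the cone over it contracts both sides. Otherwise E has a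
   successor map f, and by the prism homotopy a cocycle is a coboundary as soon
   as its shift along f is one. The shift absorbs the discrepancy between y < x,
   which appears in T', and y <= x, which dimension shifting would require. *)

Set Implicit Arguments.
Unset Strict Implicit.
Unset Printing Implicit Defensive.
Import Order.TTheory GRing.Theory.

Local Open Scope ring_scope.

(** The appended trailing zero makes every summand match [a + _]; the leading summand pulls its
    opposite forward until the two cancel. *)
Ltac zmod_cancel :=
  apply: subr0_eq; rewrite ?(opprD, opprK, oppr0, addr0, add0r) -?addrA;
  rewrite -[LHS]addr0 -?addrA;
  repeat match goal with
  | |- - ?a + (?a + _) = 0 => rewrite (addKr a)
  | |- ?a + (- ?a + _) = 0 => rewrite (addNKr a)
  | |- - ?a + _ = 0 => rewrite (addrCA _ a _)
  | |- ?a + _ = 0 => rewrite (addrCA _ (- a) _)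
  end; reflexivity.

(** * Alternating sums over faces and two chain homotopies *)

Section Coboundary.
Variable E : eqType.

(* The alternating sum of phi over the faces of s. *)
Fixpoint cobd (M : zmodType) (phi : seq E -> M) (s : seq E) : M :=
  if s is x :: s' then phi s' - cobd (fun e => phi (x :: e)) s' else 0.

Lemma cobd_cons (M : zmodType) (phi : seq E -> M) x s :
  cobd phi (x :: s) = phi s - cobd (fun e => phi (x :: e)) s.
Proof. by []. Qed.

Lemma eq_cobd (M : zmodType) (phi psi : seq E -> M) s :
  (forall e, subseq e s -> phi e = psi e) -> cobd phi s = cobd psi s.
Proof.
elim: s phi psi => // x s IHs phi psi eq_pp.
rewrite !cobd_cons eq_pp ?subseq_cons //; congr (_ - _); apply: IHs => e es.
by rewrite eq_pp //= eqxx.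
Qed.

Lemma cobdB (M : zmodType) (phi psi : seq E -> M) s :
  cobd (fun e => phi e - psi e) s = cobd phi s - cobd psi s.
Proof.
elim: s phi psi => /= [|x s IHs] phi psi; first by rewrite subr0.
by rewrite IHs; zmod_cancel.
Qed.

Lemma cobd_morph (M N : zmodType) (g : M -> N) (phi : seq E -> M) s :
  {morph g : x y / x - y} -> cobd (fun e => g (phi e)) s = g (cobd phi s).
Proof.
move=> gB; have g0 : g 0 = 0 by rewrite -(subrr 0) gB subrr.
by elim: s phi => //= x s IHs phi; rewrite gB -IHs.
Qed.

Lemma cobd_eval (M : zmodType) (phi : seq E -> E -> M) s x :
  cobd phi s x = cobd (fun e => phi e x) s.
Proof. by rewrite (cobd_morph (g := fun h => h x)). Qed.

Lemma cobd_map (f : E -> E) (M : zmodType) (phi : seq E -> M) s :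
  cobd phi (map f s) = cobd (fun e => phi (map f e)) s.
Proof. by elim: s phi => //= x s IHs phi; rewrite IHs. Qed.

Lemma cobd_cobd (M : zmodType) (phi : seq E -> M) s : cobd (cobd phi) s = 0.
Proof.
elim: s phi => //= x s IHs phi.
by rewrite cobdB IHs subr0 subrr.
Qed.

Lemma cobd_cobd_cons (M : zmodType) (phi : seq E -> M) x s :
  cobd (fun e => cobd phi (x :: e)) s = cobd phi s.
Proof. by rewrite /= cobdB cobd_cobd subr0. Qed.

(** The classical prism operator: the sum of (-1)^i phi [x_0, ..., x_i, f x_i, ..., f x_m]. *)
Fixpoint prism (f : E -> E) (M : zmodType) (phi : seq E -> M) (s : seq E) : M :=
  if s is x :: s' then
    phi [:: x, f x & map f s'] - prism f (fun e => phi (x :: e)) s'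
  else 0.

Lemma prismB f (M : zmodType) (phi psi : seq E -> M) s :
  prism f (fun e => phi e - psi e) s = prism f phi s - prism f psi s.
Proof.
elim: s phi psi => /= [|x s IHs] phi psi; first by rewrite subr0.
by rewrite IHs; zmod_cancel.
Qed.

Lemma prism_homotopy f (M : zmodType) (phi : seq E -> M) s :
  cobd (prism f phi) s + prism f (cobd phi) s = phi (map f s) - phi s.
Proof.
elim: s phi => /= [|x s IHs] phi; first by rewrite subrr addr0.
have /(canRL (addrK _)) IH := IHs (fun e => phi (x :: e)).
rewrite cobdB prismB cobd_map IH.
by zmod_cancel.
Qed.

(** In closed form, [phi (rcons s mu)] with sign (-1)^(size s). The apex goes last, where a maximum
    keeps the list increasing. *)
Fixpoint cone (mu : E) (M : zmodType) (phi : seq E -> M) (s : seq E) : M :=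
  if s is x :: s' then - cone mu (fun e => phi (x :: e)) s' else phi [:: mu].

Lemma coneB mu (M : zmodType) (phi psi : seq E -> M) s :
  cone mu (fun e => phi e - psi e) s = cone mu phi s - cone mu psi s.
Proof.
by elim: s phi psi => //= x s IHs phi psi; rewrite IHs opprB opprK addrC.
Qed.

Lemma cobdN (M : zmodType) (phi : seq E -> M) s :
  cobd (fun e => - phi e) s = - cobd phi s.
Proof. by apply: (cobd_morph (g := -%R)) => x y; rewrite opprD. Qed.

Lemma cone_homotopy mu (M : zmodType) (phi : seq E -> M) s :
  cobd (cone mu phi) s + cone mu (cobd phi) s = phi s.
Proof.
elim: s phi => /= [|x s IHs] phi; first by rewrite subr0 add0r.
have <- := IHs (fun e => phi (x :: e)).
by rewrite coneB cobdN; zmod_cancel.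
Qed.

End Coboundary.

(** * Cohomology of systems of quotients *)

Section Systems.
Context {d : Order.disp_t} {E : orderType d}.

Local Notation incr := (sorted <%O).

Section Cohomology.
Variable M : zmodType.

(* The system of quotients M / T x, x in E, with the projections
   M / T x -> M / T y for y <= x. *)
Record subgroup_system (T : E -> M -> Prop) : Prop := SubgroupSystem {
  sys0 : forall x, T x 0;
  sysB : forall x u v, T x u -> T x v -> T x (u - v);
  sys_le : forall x y u, (y <= x)%O -> T x u -> T y u }.

(** The least entry [x] indexes the quotient to which the values at all faces project. Cochains are
    total on lists, but only increasing lists of the right length matter. *)
Definition cocycle (T : E -> M -> Prop) (m : nat) (phi : seq E -> M) :=
  forall x s, incr (x :: s) -> size s = m -> T x (cobd phi (x :: s)).

Definition coboundary (T : E -> M -> Prop) (m : nat) (phi : seq E -> M) :=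
  exists psi : seq E -> M, forall x s, incr (x :: s) -> (size s).+1 = m ->
    T x (cobd psi (x :: s) - phi (x :: s)).

Definition has_cohomology (T : E -> M -> Prop) (m : nat) :=
  exists phi : seq E -> M, cocycle T m phi /\ ~ coboundary T m phi.

End Cohomology.

Section Theory.
Variables (M : zmodType) (T : E -> M -> Prop).
Hypothesis T_sys : subgroup_system T.

Let T0 := sys0 T_sys.
Let TB := sysB T_sys.

Lemma sysN x u : T x u -> T x (- u).
Proof. by move=> Tu; rewrite -sub0r; apply: TB. Qed.

Lemma sysD x u v : T x u -> T x v -> T x (u + v).
Proof. by move=> Tu Tv; rewrite -[v]opprK; apply/TB/sysN. Qed.

Lemma cobd_in x (phi : seq E -> M) s :
  (forall e, subseq e s -> (size e).+1 = size s -> T x (phi e)) ->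
  T x (cobd phi s).
Proof.
elim: s phi => //= y s IHs phi Tphi; apply: TB.
  by apply: Tphi => //; apply: subseq_cons.
by apply: IHs => e es sz_e; apply: Tphi; rewrite /= ?eqxx ?sz_e.
Qed.

Lemma cone_in x mu (phi : seq E -> M) s :
  T x (phi (rcons s mu)) -> T x (cone mu phi s).
Proof. by elim: s phi => //= y s IHs phi Tphi; apply/sysN/IHs. Qed.

(** The error in [cone_homotopy] is, up to sign, [cobd phi (rcons s mu)], which the cocycle
    condition puts in [T x]. *)
Lemma coboundary_of_max mu m (phi : seq E -> M) :
  (forall x : E, (x <= mu)%O) -> cocycle T m phi -> coboundary T m phi.
Proof.
move=> mu_max phiT.
(* On lists containing [mu] the cone would repeat it, hence the value 0. If [mu] is in [s], it is
   the last entry, and only the face omitting it contributes, giving exactly [ph s]. *)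
pose psi (ph : seq E -> M) (e : seq E) := if mu \in e then 0 else cone mu ph e.
have psi_mu ph s : incr s -> mu \in s -> cobd (psi ph) s = ph s.
  elim: s ph => // x s IHs ph xs; rewrite inE.
  case: s => [|y s] in xs IHs *.
    by rewrite orbF => /eqP <-; rewrite /= subr0 /psi in_nil.
  have xmu : (x < mu)%O.
    by move: xs => /= /andP[xy _]; apply: lt_le_trans xy (mu_max y).
  rewrite (gt_eqF xmu) orFb => mu_s.
  transitivity (- cobd (fun e => - psi (fun e => ph (x :: e)) e) (y :: s)).
    rewrite cobd_cons {1}/psi mu_s sub0r; congr (- _); apply: eq_cobd => e _.
    by rewrite /psi inE (gt_eqF xmu) /=; case: ifP; rewrite ?oppr0.
  rewrite cobdN opprK; apply: IHs mu_s.
  by move: xs => /= /andP[].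
exists (psi phi) => x s xs sz_s.
have [mu_s|mu_s] := boolP (mu \in x :: s); first by rewrite psi_mu // subrr.
have -> : cobd (psi phi) (x :: s) = cobd (cone mu phi) (x :: s).
  apply: eq_cobd => e /mem_subseq es; rewrite /psi ifN //.
  by apply: contra mu_s; apply: es.
rewrite -[phi (x :: s)](cone_homotopy mu) opprD addNKr; apply/sysN/cone_in.
rewrite rcons_cons; apply: phiT; last by rewrite size_rcons.
rewrite /= rcons_path; apply/andP; split=> //.
rewrite lt_neqAle mu_max andbT; apply: contraNneq mu_s => <-.
exact: mem_last.
Qed.

Section Shift.
Variable f : E -> E.
Hypotheses (f_gt : forall x : E, (x < f x)%O)
  (f_incr : {homo f : x y / (x < y)%O}).

Lemma map_incr s : incr s -> incr (map f s).
Proof. by apply: homo_sorted. Qed.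

Lemma shift_incr x s : incr (x :: s) -> incr [:: x, f x & map f s].
Proof. by move=> /map_incr /= xs; rewrite f_gt. Qed.

Lemma prism_in x (phi : seq E -> M) s : incr s ->
  (forall u, incr u -> size u = (size s).+1 -> ohead u = ohead s ->
     T x (phi u)) ->
  T x (prism f phi s).
Proof.
elim: s phi => //= y s IHs phi ys Tphi; apply: TB.
  by apply: Tphi => //=; [apply: (@shift_incr y s)|rewrite size_map].
apply: IHs => [|u u_incr sz_u hd_u]; first exact: path_sorted ys.
apply: Tphi => //=; last by rewrite sz_u.
case: u s u_incr sz_u hd_u ys => [|z u] [|z' s] //= u_incr _ [<-].
by case/andP=> ->.
Qed.

(** The prism over [x :: s] uses only increasing lists starting with [x], so [prism f (cobd phi)]
    lies in [T x]. The shift has to be bounded only modulo [T x], not [T (f x)]. *)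
Lemma coboundary_shift m (phi : seq E -> M) :
  cocycle T m phi -> coboundary T m (fun s => phi (map f s)) ->
  coboundary T m phi.
Proof.
move=> phiT [psi psiP]; exists (fun e => psi e - prism f phi e) => x s xs sz_s.
have /(canRL (addrK _)) Hx := prism_homotopy f phi (x :: s).
have zm (a b c h : M) : a - (b - c - h) - c = (a - b) + h by zmod_cancel.
rewrite cobdB Hx zm.
apply: sysD; first exact: psiP.
apply: prism_in => // -[|y u] //= yu [sz_u] [eyx]; rewrite eyx in yu *.
by apply: phiT; rewrite // sz_u.
Qed.

End Shift.
End Theory.

(** * Dimension shifting *)

Section LocalSystem.
Variables (M : zmodType) (T : E -> M -> Prop).
Hypothesis T_sys : subgroup_system T.

Let TB := sysB T_sys.

(** The quotient by [local_system x] is the product of the M / T y, y < x, modulo the diagonal image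
    of M. *)
Definition local_system : E -> (E -> M) -> Prop :=
  fun x v => exists t : M, forall y, (y < x)%O -> T y (t - v y).

Lemma local_system_sys : subgroup_system local_system.
Proof.
split.
- by move=> x; exists 0 => y _; rewrite subrr; apply: sys0 T_sys _.
- move=> x u v [t tP] [t' t'P]; exists (t - t') => y yx.
  have -> : t - t' - (u - v) y = t - u y - (t' - v y).
    by rewrite /= -[(u - v) y]/(u y - v y); zmod_cancel.
  by apply: TB; [apply: tP | apply: t'P].
- by move=> x y u yx [t tP]; exists t => z zy; apply: tP; apply: lt_le_trans yx.
Qed.

Variable f : E -> E.
Hypotheses (f_gt : forall x : E, (x < f x)%O)
  (f_incr : {homo f : x y / (x < y)%O}).

Lemma has_cohomology_local m :
  has_cohomology T m.+2 -> has_cohomology local_system m.+1.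
Proof.
case=> phi [phiT phi_ntriv]; exists (fun b y => phi (y :: b)); split.
  move=> x s xs sz_s; exists (phi (x :: s)) => y yx.
  rewrite cobd_eval; apply: (phiT y (x :: s)); last by rewrite /= sz_s.
  by move: xs => /= ->; rewrite yx.
case=> Psi PsiP; apply/phi_ntriv/(coboundary_shift T_sys f_gt) => //.
have /choice[t tP] : forall b, exists t : M, incr b -> size b = m.+1 ->
    forall y, path <%O y b -> T y (t - (cobd Psi b y - phi (y :: b))).
  case=> [|x s]; first by exists 0.
  have [xs|nxs] := boolP (incr (x :: s)); last by exists 0.
  have [sz_s|sz_s] := eqVneq (size s).+1 m.+1; last first.
    by exists 0 => _ /= sz_s'; rewrite sz_s' eqxx in sz_s.
  have [t tP] := PsiP x s xs sz_s.
  by exists t => _ _ y /= /andP[yx _]; apply: tP.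
(* All faces of [map f (x :: s)] start above [x], so [tP] applies to them at [x] itself; unshifted
   faces starting with [x] would only allow y < x. *)
exists (fun b => - t (map f b)) => x s xs [sz_s].
have /= /andP[xfx fxs] := shift_incr f_gt f_incr xs.
have fs : incr (map f s) by apply: path_sorted fxs.
have xs' : path <%O x (map f s) by apply: path_le fxs => //; apply: lt_trans.
set fx := f x in xfx fxs *; set a := map f s in fs fxs xs' *.
have sz_a : size a = m.+1 by rewrite size_map.
have coh : T x (phi (fx :: a) -
    (phi (x :: a) - cobd (fun e => phi [:: x, fx & e]) a)).
  by apply: (phiT x (fx :: a)); rewrite /= ?xfx ?fxs ?sz_a.
have Ta := tP a fs sz_a x xs'.
have : T x (cobd (fun e => t (fx :: e) -
    (cobd Psi (fx :: e) x - phi [:: x, fx & e])) a).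
  apply: (cobd_in T_sys) => e ea sz_e.
  have fxe : path <%O fx e by apply: subseq_path fxs => //; apply: lt_trans.
  by apply: tP; rewrite //= ?xfx //; move: sz_e; rewrite sz_a.
(* Thus the [Psi] terms of the two congruences for [t] cancel, and [coh] turns the remaining [phi]
   terms into [phi (fx :: a)]. *)
have Psi_x : cobd (fun e => cobd Psi (fx :: e) x) a = cobd Psi a x.
  by rewrite -(cobd_eval (fun e => cobd Psi (fx :: e))) cobd_cobd_cons.
rewrite (cobdB (fun e => t (fx :: e))) (cobdB (fun e => cobd Psi (fx :: e) x)).
rewrite Psi_x => Tfx.
rewrite cobdN opprK -(cobd_map f (fun e => t (fx :: e))) -/a.
have zm (u P c ta p q : M) :
    - ta + u - q = u - (P - c) - (ta - (P - p)) - (q - (p - c)).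
  by zmod_cancel.
by have := TB (TB Tfx Ta) coh; rewrite -zm.
Qed.

Lemma local_has_cohomology m :
  has_cohomology local_system m.+1 -> has_cohomology T m.+2.
Proof.
case=> Phi [PhiT Phi_ntriv].
(* The connecting homomorphism sends [x :: c] to an element t witnessing that [cobd Phi] at
   [map f (x :: c)] is local. Since x < f x, evaluation at [x] yields t modulo [T x] without a
   choice. *)
exists (fun s => if s is x :: c then cobd Phi (f x :: map f c) x else 0).
split.
  move=> x [//|y s] xys [sz_s].
  have [t tP] : local_system (f y) (cobd Phi (map f (y :: s))).
    apply: (PhiT (f y) (map f s)); last by rewrite size_map.
    by apply: (@map_incr _ f_incr (y :: s)); move: xys => /= /andP[].
  rewrite cobd_cons.
  have -> : cobd (fun c => cobd Phi (f x :: map f c) x) (y :: s) =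
      cobd Phi (map f (y :: s)) x.
    rewrite -(cobd_map f (fun c => cobd Phi (f x :: c) x)).
    by rewrite -(cobd_eval (fun c => cobd Phi (f x :: c))) cobd_cobd_cons.
  have xy : (x < y)%O by move: xys => /= /andP[].
  have zm (u v : M) : u - v = (t - v) - (t - u) by zmod_cancel.
  rewrite [X in T x X]zm; apply: TB.
    by apply: tP; apply: lt_trans (f_gt y).
  by apply: (sys_le T_sys) (tP y (f_gt y)); apply: ltW.
case=> psi psiP.
apply/Phi_ntriv/(coboundary_shift local_system_sys f_gt) => //.
(* In [psiP] at [x :: y :: c], the faces keeping [x] or [f x] form the coboundary of this cochain.
   The other two are the shift of [Phi] and [psi (y :: c)], whence the witness. *)
exists (fun e x => Phi (f x :: map f e) x - psi (x :: e)) => y c yc sz_c.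
exists (- psi (y :: c)) => x xy.
have : T x (cobd psi [:: x, y & c] - cobd Phi (f x :: map f (y :: c)) x).
  by apply: (psiP x (y :: c)); rewrite /= ?xy ?sz_c.
move/(sysN T_sys); rewrite [cobd psi _]cobd_cons cobd_cons.
rewrite [cobd Phi _]cobd_cons cobd_map.
have subE (u v : E -> M) : (u - v) x = u x - v x by [].
rewrite !subE !cobd_eval cobdB.
have zm (a b p q : M) : - (a - b - (p - q)) = - a - (q - b - p) by zmod_cancel.
by rewrite zm.
Qed.

End LocalSystem.
End Systems.

(** * Transport along group isomorphisms *)

Section Transfer.
Context {d : Order.disp_t} {E : orderType d}.
Variables (M N : zmodType) (T : E -> M -> Prop) (g : N -> M).
Hypothesis gB : {morph g : x y / x - y}.

Lemma subgroup_system_pullback :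
  subgroup_system T -> subgroup_system (fun x v => T x (g v)).
Proof.
case=> T0 TB T_le; split.
- by move=> x; rewrite -(subrr 0) gB subrr.
- by move=> x u v Tu Tv; rewrite gB; apply: TB.
- by move=> x y u; apply: T_le.
Qed.

Lemma has_cohomology_pullback (h : M -> N) m : cancel g h -> cancel h g ->
  has_cohomology T m <-> has_cohomology (fun x v => T x (g v)) m.
Proof.
move=> gK hK; split=> -[phi [phiT phi_ntriv]].
  exists (fun e => h (phi e)); split=> [x s xs sz_s|[psi psiP]].
    rewrite -cobd_morph //; under eq_cobd => e _ do rewrite hK.
    exact: phiT.
  apply: phi_ntriv; exists (fun e => g (psi e)) => x s xs sz_s.
  by rewrite cobd_morph // -[phi _]hK -gB; apply: psiP.
exists (fun e => g (phi e)); split=> [x s xs sz_s|[psi psiP]].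
  by rewrite cobd_morph //; apply: phiT.
apply: phi_ntriv; exists (fun e => h (psi e)) => x s xs sz_s.
rewrite gB -cobd_morph //; under eq_cobd => e _ do rewrite hK.
exact: psiP.
Qed.

End Transfer.

(** * The two notions as cohomology *)

Section Families.
Context {d : Order.disp_t} {E : orderType d} {A : zmodType}.

Definition fin_system : E -> (E -> A) -> Prop :=
  fun x v => finite_set [set y | below x y /\ v y <> 0].

Definition triv_system k : E -> (k.+1.-tuple E -> A) -> Prop :=
  fun x v => fun_trivial (below x) v.

Lemma fin_system_sys : subgroup_system fin_system.
Proof.
split.
- by move=> x; apply: (@sub_finite_set _ _ set0) => [y []|//].
- move=> x u v uT vT.
  have uvT := conj uT vT; rewrite -finite_setU in uvT.
  apply: sub_finite_set uvT => y [yx uvy].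
  have [uy|] := pselect (u y = 0); last by left.
  right; split=> // vy; apply: uvy.
  by rewrite -[LHS]/(u y - v y) uy vy subr0.
- move=> x y u yx; apply: sub_finite_set => z [zy uz]; split=> //.
  exact: lt_le_trans yx.
Qed.

Let untuple1 (v : 1.-tuple E -> A) : E -> A := fun x => v [tuple x].
Let tuple1 (v : E -> A) : 1.-tuple E -> A := fun t => v (thead t).

(** Pulling [local_system (triv_system k)] back along this bijection gives [triv_system k.+1] by
    unfolding [fun_trivial]. *)
Let untuple_last k (v : k.+2.-tuple E -> A) : E -> k.+1.-tuple E -> A :=
  fun x s => v [tuple of rcons s x].
Let tuple_last k (v : E -> k.+1.-tuple E -> A) : k.+2.-tuple E -> A :=
  fun t => v (last (thead t) (behead t)) [tuple of belast (thead t) (behead t)].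

Lemma triv_system_sys k : subgroup_system (@triv_system k).
Proof.
elim: k => [|k IHk].
  exact: (subgroup_system_pullback (g := untuple1)) fin_system_sys.
exact: (subgroup_system_pullback (g := @untuple_last k)) (local_system_sys IHk).
Qed.

Lemma has_cohomology_triv0 m :
  has_cohomology fin_system m <-> has_cohomology (@triv_system 0) m.
Proof.
apply: (@has_cohomology_pullback _ _ _ _ _ untuple1 _ tuple1) => // v.
apply/funext => t; rewrite /untuple1 /tuple1; congr v.
by case/tupleP: t => x t; rewrite tuple0 theadE; apply: val_inj.
Qed.

Lemma has_cohomology_trivS k m :
  has_cohomology (local_system (@triv_system k)) m <->
  has_cohomology (@triv_system k.+1) m.
Proof.
apply: (@has_cohomology_pullback _ _ _ _ _ (@untuple_last k) _ (@tuple_last k)).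
- by [].
- move=> v; apply/funext => t; rewrite /untuple_last /tuple_last; congr v.
  case/tupleP: t => x t; apply: val_inj => /=.
  by rewrite theadE -lastI.
- move=> v; apply/funext => x; apply/funext => s.
  rewrite /untuple_last /tuple_last; case/tupleP: s => y s.
  congr (v _ _); first by rewrite /= last_rcons.
  by apply: val_inj => /=; rewrite belast_rcons.
Qed.

(** Each dimension shift trades one degree for one more coordinate. *)
Lemma has_cohomology_triv_shift (f : E -> E) k m :
  (forall x, (x < f x)%O) -> {homo f : x y / (x < y)%O} ->
  has_cohomology (@triv_system k) m.+1 <->
  has_cohomology (@triv_system (m + k)) 1.
Proof.
move=> f_gt f_incr; elim: m k => [//|m IHm] k.
rewrite addSnnS -IHm -has_cohomology_trivS; split.
  exact: (has_cohomology_local (triv_system_sys k) f_gt f_incr).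
exact: (local_has_cohomology (triv_system_sys k) f_gt f_incr).
Qed.

Lemma altsumE n (phi : seq E -> E -> A) (a : n.+1.-tuple E) :
  altsum (fun t : n.-tuple E => phi t) a = cobd phi a.
Proof.
apply/funext => x; rewrite cobd_eval.
suff sumE (psi : seq E -> A) :
    \sum_(i < n.+1) psi (omit i a) *~ (-1) ^+ i = cobd psi a.
  exact: (sumE (fun e => phi e x)).
elim: n {phi} psi a => [|n IHn] phi a.
  rewrite big_ord_recl big_ord0 addr0 expr0 mulr1z.
  by case/tupleP: a => y a; rewrite [omit _ _]tuple0 [a]tuple0 /= subr0.
case/tupleP: a => y a; rewrite big_ord_recl expr0 mulr1z cobd_cons -IHn -sumrN.
congr (_ + _).
  congr phi; apply: congr1; apply: eq_from_tnth => i.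
  by rewrite tnth_mktuple !(tnth_nth y).
apply: eq_bigr => i _; rewrite exprS mulN1r mulrNz; congr (- (phi _ *~ _)).
rewrite -[RHS]/(val [tuple of y :: omit i a]); apply: congr1.
apply: eq_from_tnth => j; rewrite tnth_mktuple.
case: (unliftP ord0 j) => [j'|] ->; last by rewrite !(tnth_nth y).
rewrite tnthS tnth_mktuple !(tnth_nth y).
by rewrite /= /bump !leq0n !add1n ltnS addnS.
Qed.

(** Families indexed by tuples extend by 0 to lists, on which [cobd] recurses. *)
Lemma extend_tuple_fun n (M : zmodType) (phi : n.-tuple E -> M) :
  exists phi' : seq E -> M, phi = fun t : n.-tuple E => phi' t.
Proof.
exists (fun s => oapp phi 0 (insub s)); apply/funext => t.
by rewrite valK.
Qed.

Lemma fin_systemB x (u v : E -> A) :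
  fin_system x (u - v) = eqfin (below x) u v.
Proof.
congr finite_set; apply/seteqP; split=> y [yx uvy]; split=> // eq_y.
  by apply: uvy; rewrite -[LHS]/(u y - v y) eq_y subrr.
exact/uvy/subr0_eq.
Qed.

Lemma coherentIE n (phi : seq E -> E -> A) :
  coherentI (fun t : n.+1.-tuple E => phi t) <-> cocycle fin_system n.+1 phi.
Proof.
split=> phiT.
  move=> x s xs /eqP sz_s; pose a := [tuple of x :: Tuple sz_s].
  by have := phiT a xs; rewrite altsumE.
move=> a; case/tupleP: a => x s xs; rewrite altsumE theadE.
by apply: phiT; rewrite ?size_tuple.
Qed.

Lemma trivialIE n (phi : seq E -> E -> A) :
  trivialI (fun t : n.+1.-tuple E => phi t) <-> coboundary fin_system n.+1 phi.
Proof.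
have bdI : (exists psi : n.-tuple E -> E -> A,
    forall a : n.+1.-tuple E, increasing a ->
      eqfin (below (thead a)) (altsum psi a) (phi a)) <->
    coboundary fin_system n.+1 phi.
  split=> [[psi0]|[psi psiP]].
    have [psi ->] := extend_tuple_fun psi0 => psiP.
    exists psi => x s xs [/eqP sz_s]; pose a := [tuple of x :: Tuple sz_s].
    by have := psiP a xs; rewrite altsumE fin_systemB.
  exists (fun t => psi t) => a; case/tupleP: a => x s xs.
  rewrite altsumE theadE -fin_systemB.
  by apply: psiP; rewrite ?size_tuple.
(* For 1-tuples, the trivializing function is the value of a cochain at [[::]]. *)
case: n bdI => [|n] // _; split=> [[f fP]|[psi psiP]].
  by exists (fun=> f) => x [|//] _ _; rewrite /= subr0; apply: fP.
exists (psi [::]) => x.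
by have := psiP x [::] isT erefl; rewrite /= subr0.
Qed.

Lemma familiesI n :
  (exists phi : n.+1.-tuple E -> E -> A, coherentI phi /\ ~ trivialI phi) <->
  has_cohomology fin_system n.+1.
Proof.
split=> [[phi0]|[phi]].
  have [phi ->] := extend_tuple_fun phi0.
  by rewrite coherentIE trivialIE; exists phi.
by rewrite -coherentIE -trivialIE; exists (fun t : n.+1.-tuple E => phi t).
Qed.

(** [cobd phi [:: x; y]] is [phi [:: y] - phi [:: x]], so coherence is the cocycle condition in
    degree 1; only the value of [psi] at [[::]] enters its coboundary. *)
Lemma familiesII n :
  (exists s : E -> n.+1.-tuple E -> A,
     coherentII [set: E]%classic s /\ ~ trivialII [set: E]%classic s) <->
  has_cohomology (@triv_system n) 1.
Proof.
have sys := triv_system_sys n.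
split=> [[s [s_coh s_ntriv]]|[phi [phiT phi_ntriv]]].
  exists (fun e => if e is x :: _ then s x else 0); split.
    move=> x [|y [|//]] //= xy _; rewrite !subr0.
    by apply: s_coh => //; apply: ltW; move: xy; rewrite andbT.
  case=> psi psiP; apply: s_ntriv; exists (psi [::]) => x _.
  by have := psiP x [::] isT erefl; rewrite /= subr0.
exists (fun x => phi [:: x]); split.
  move=> x y _ _; rewrite le_eqVlt => /predU1P[->|xy].
    by have := sys0 sys y; rewrite -(subrr (phi [:: y])).
  have := phiT x [:: y]; rewrite /= !subr0; apply=> //.
  by rewrite xy.
case=> t tP; apply: phi_ntriv; exists (fun=> t) => x [|//] _ _.
by rewrite /= subr0; apply: tP.
Qed.

Lemma exists_succ : well_order (<=%O : rel E) ->
  (forall x : E, exists y, (x < y)%O) ->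
  exists2 f : E -> E, forall x, (x < f x)%O & {homo f : x y / (x < y)%O}.
Proof.
move=> E_wo nmax.
have /choice[f fP] : forall x, exists y : E, (x < y)%O /\
    forall z, (x < z)%O -> (y <= z)%O.
  move=> x; have [y xy] := nmax x.
  have [|z [[xz z_min] _]] := E_wo [pred y | (x < y)%O]; first by exists y.
  by exists z; split=> // t xt; apply: z_min.
exists f => [x|x y xy]; first by have [] := fP x.
have [_ /(_ _ xy) fxy] := fP x; have [yfy _] := fP y.
exact: le_lt_trans fxy yfy.
Qed.

End Families.

Theorem theorem7p10 (n : nat) (n_gt0 : (0 < n)%N)
    (d : Order.disp_t) (E : orderType d) (E_wo : well_order (<=%O : rel E))
    (A : zmodType) :
  (exists phi : n.-tuple E -> E -> A, coherentI phi /\ ~ trivialI phi) <->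
  (exists s : E -> n.-tuple E -> A,
     coherentII [set: E]%classic s /\ ~ trivialII [set: E]%classic s).
Proof.
case: n n_gt0 => // n _; rewrite familiesI familiesII.
have [[mu mu_max]|nmax] := pselect (exists mu : E, forall x, (x <= mu)%O).
  have nc (M : zmodType) (T : E -> M -> Prop) m :
      subgroup_system T -> ~ has_cohomology T m.+1.
    by move=> T_sys [phi [phiT]]; apply; apply: coboundary_of_max phiT.
  by split=> [/nc|/nc] []; [apply: fin_system_sys | apply: triv_system_sys].
(* The empty ordinal also falls under this case. *)
have [|f f_gt f_incr] := exists_succ E_wo.
  move=> x; apply: contra_notP nmax => /forallNP x_max; exists x => y.
  by rewrite leNgt; apply/negP/x_max.
rewrite has_cohomology_triv0 (has_cohomology_triv_shift 0 n f_gt f_incr).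
by rewrite addn0.
Qed.
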